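(* Consider a GLM with independent $Y_i$, $i=1,\ldots,n$, having densities $f_{\theta_i}(y)=\exp\{(y\theta_i-b(\theta_i))/a+c(y,a)\}$ and canonical link $\boldsymbol{\theta}=X\boldsymbol{\beta}$, where $X$ is a deterministic $n\times p$ matrix of rank $r$ any $r$ columns of which are linearly independent, and suppose Assumption (A) holds. There exist absolute constants $\tilde c\in(0,1)$ and $C_2>0$ such that the following holds. Let $1\le p_0\le r$ and assume $\widetilde{\mathcal{B}}(p_0)\subseteq\mathcal{B}(p_0)$, where $\widetilde{\mathcal{B}}(p_0)$ is defined in the context (using $\tilde c$). Then $$\inf_{\widehat{\boldsymbol{\theta}}}\sup_{\boldsymbol{\beta}\in\mathcal{B}(p_0)}\mathbb{E}\,KL(X\boldsymbol{\beta},\widehat{\boldsymbol{\theta}})\ge\begin{cases}C_2\,\frac{\mathcal{L}}{\mathcal{U}}\,\tau[2p_0]\,p_0\ln\!\big(\frac{pe}{p_0}\big), & 1\le p_0\le r/2,\\[2pt] C_2\,\frac{\mathcal{L}}{\mathcal{U}}\,\tau[p_0]\,r, & r/2\le p_0\le r,\end{cases}$$ where the infimum is over all estimators $\widehat{\boldsymbol{\theta}}$ of $\boldsymbol{\theta}$.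
   Context: Assumption (A): $\Theta\subseteq\mathbb{R}$ is a closed interval; $b$ is twice differentiable with $\sup_{t\in\mathbb{R}}b''(t)\le\mathcal{U}$ and $\inf_{t\in\Theta}b''(t)\ge\mathcal{L}$ for constants $0<\mathcal{L}\le\mathcal{U}<\infty$; $a>0$. $KL(\boldsymbol{\theta},\boldsymbol{\zeta})=\frac1a\sum_{i=1}^n\{b'(\theta_i)(\theta_i-\zeta_i)-b(\theta_i)+b(\zeta_i)\}$. $\|\boldsymbol\beta\|_0$ is the number of nonzero entries; $\mathcal{B}(p_0)=\{\boldsymbol{\beta}\in\mathbb{R}^p:\boldsymbol{\beta}^t\mathbf{x}_i\in\Theta\ \forall i,\ \|\boldsymbol{\beta}\|_0\le p_0\}$, $\mathbf{x}_i^t$ the rows of $X$. For $k\le r$: $\phi_{\min}[k]=\min_{1\le\|\boldsymbol\beta\|_0\le k}\|X\boldsymbol\beta\|^2/\|\boldsymbol\beta\|^2$, $\phi_{\max}[k]=\max_{1\le\|\boldsymbol\beta\|_0\le k}\|X\boldsymbol\beta\|^2/\|\boldsymbol\beta\|^2$, $\tau[k]=\phi_{\min}[k]/\phi_{\max}[k]$. The set $\widetilde{\mathcal{B}}(p_0)$: if $p_0\le r/2$, it is the set of $\boldsymbol\beta\in\{0,C_{p_0}\}^p$ with exactly $p_0$ entries equal to $C_{p_0}$, where $C_{p_0}^2=\frac{1}{16}\tilde c\,\frac{a}{\mathcal U}\,\phi_{\max}[2p_0]^{-1}\ln(pe/p_0)$; if $r/2\le p_0\le r$, it is the set of $\boldsymbol\beta$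 whose first $p_0$ coordinates lie in $\{0,C_{p_0}\}$ and whose remaining coordinates are $0$, where $C_{p_0}^2=\frac{\ln 2}{64}\frac{a}{\mathcal U}\phi_{\max}[p_0]^{-1}$. *)

(* Defs.v *)
(* Real numbers: Stdlib's R (a realType via Rstruct),
   so that "absolute constants" are genuine fixed real numbers. *)
From HB Require Import structures.
From mathcomp Require Import all_boot all_order all_algebra.
From mathcomp Require Import all_classical all_reals all_analysis.
From mathcomp Require Import Rstruct Rstruct_topology.
Set Implicit Arguments.
Unset Strict Implicit.
Unset Printing Implicit Defensive.
Import Order.TTheory GRing.Theory Num.Theory.
Import numFieldNormedType.Exports.
Local Open Scope classical_set_scope.
Local Open Scope ring_scope.

Section GLMDefs.
Variable R : realType.

Definition l0norm (p : nat) (beta : 'cV[R]_p) : nat := #|[set j | beta j 0 != 0]|.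

Definition sqnorm (m : nat) (v : 'cV[R]_m) : R := \sum_(i < m) (v i 0) ^+ 2.

(* phi_min[k], phi_max[k] : min / max of ||X b||^2/||b||^2 over 1 <= ||b||_0 <= k
   (the min / max exists; written as inf / sup of the set of values) *)
Definition ratio_set (n p : nat) (X : 'M[R]_(n, p)) (k : nat) : set R :=
  [set sqnorm (X *m beta) / sqnorm beta |
     beta in [set beta : 'cV[R]_p | (1 <= l0norm beta <= k)%N]].
Definition phi_min (n p : nat) (X : 'M[R]_(n, p)) (k : nat) : R := inf (ratio_set X k).
Definition phi_max (n p : nat) (X : 'M[R]_(n, p)) (k : nat) : R := sup (ratio_set X k).
Definition tau (n p : nat) (X : 'M[R]_(n, p)) (k : nat) : R := phi_min X k / phi_max X k.

Definition linpred (n p : nat) (X : 'M[R]_(n, p)) (beta : 'cV[R]_p) : 'I_n -> R :=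
  fun i => (X *m beta) i 0.

Definition Bset (n p : nat) (X : 'M[R]_(n, p)) (Theta : set R) (p0 : nat) : set 'cV[R]_p :=
  [set beta | (forall i, Theta (linpred X beta i)) /\ (l0norm beta <= p0)%N].

Definition KL (n : nat) (a : R) (b : R -> R) (theta zeta : 'I_n -> R) : R :=
  a^-1 * \sum_(i < n) ((derive1 b) (theta i) * (theta i - zeta i) - b (theta i) + b (zeta i)).

(* density f_theta(y) = exp{(y theta - b(theta))/a + c(y,a)} w.r.t. the base measure;
   c y stands for c(y,a) (a is fixed) *)
Definition dens (a : R) (b c : R -> R) (theta y : R) : R :=
  expR ((y * theta - b theta) / a + c y).

(* Iterated integral w.r.t. nu over the coordinates listed in s (the remaining
   coordinates are taken from y). Used with s = enum 'I_n this is the integral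
   against the n-fold product measure nu^n (Tonelli; integrands below are >= 0). *)
Fixpoint iint (n : nat) (nu : {measure set R -> \bar R}) (s : seq 'I_n)
    (G : ('I_n -> R) -> \bar R) (y : 'I_n -> R) : \bar R :=
  match s with
  | [::] => G y
  | k :: s' => (\int[nu]_t iint nu s' G (fun j => if j == k then t else y j))%E
  end.

Definition expect (n : nat) (nu : {measure set R -> \bar R}) (a : R) (b c : R -> R)
    (theta : 'I_n -> R) (g : ('I_n -> R) -> \bar R) : \bar R :=
  iint nu (enum 'I_n)
    (fun y => ((\prod_(i < n) dens a b c (theta i) (y i))%:E * g y)%E) (fun _ => 0).

Definition prod_measurable (n : nat) : set (set ('I_n -> R)) :=
  <<s [set A | exists i : 'I_n, exists B : set R,
                 measurable B /\ A = (fun y : 'I_n -> R => y i) @^-1` B] >>.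

Definition estimator (n : nat) (th : ('I_n -> R) -> ('I_n -> R)) : Prop :=
  forall (i : 'I_n) (B : set R), measurable B ->
    prod_measurable ((fun y => th y i) @^-1` B).

Definition maxrisk (n p : nat) (X : 'M[R]_(n, p)) (Theta : set R) (p0 : nat)
    (nu : {measure set R -> \bar R}) (a : R) (b c : R -> R)
    (th : ('I_n -> R) -> ('I_n -> R)) : \bar R :=
  ereal_sup [set expect nu a b c (linpred X beta)
                   (fun y => (KL a b (linpred X beta) (th y))%:E)
            | beta in Bset X Theta p0].

(* widetilde B(p0), case p0 <= r/2 *)
Definition Btilde1 (n p : nat) (X : 'M[R]_(n, p)) (ct a U : R) (p0 : nat) : set 'cV[R]_p :=
  let C := Num.sqrt (16^-1 * ct * (a / U) * (phi_max X (2 * p0))^-1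
                      * ln (p%:R * expR 1 / p0%:R)) in
  [set beta | (forall j, beta j 0 = 0 \/ beta j 0 = C) /\
              #|[set j | beta j 0 == C]| = p0].

(* widetilde B(p0), case r/2 <= p0 <= r *)
Definition Btilde2 (n p : nat) (X : 'M[R]_(n, p)) (a U : R) (p0 : nat) : set 'cV[R]_p :=
  let C := Num.sqrt (ln 2 / 64 * (a / U) * (phi_max X p0)^-1) in
  [set beta | forall j : 'I_p,
     ((j < p0)%N -> beta j 0 = 0 \/ beta j 0 = C) /\ ((p0 <= j)%N -> beta j 0 = 0)].

End GLMDefs.

Notation RR := (Rdefinitions.R : realType).

(* Main.v *)
(* Put hypotheses [beta_f = C 1_(S f)] on words [f] of length [p0] over an alphabet
   of size [m]: in the sparse case one index is chosen in each of [p0] blocks of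
   size [m = p %/ p0], in the dense case [m = 2] and the word is the support itself.
   At a fixed observation [y], strong convexity of [b] on [Theta] together with
   convexity of the log-partition function forces all hypotheses of small loss into
   a single Hamming ball, which contains exponentially few words.  Conversely, since
   [f_theta^2 = K f_(2 theta) f_0] with [ln K <= U theta^2 / a], AM-GM bounds each
   [f_theta] by a small multiple of [f_(2 theta)] plus a large multiple of [f_0].
   Summing over the ball bounds the posterior mass of small loss pointwise in [y];
   integrating gives a lower bound for the average risk, without packing sets,
   without Fano's inequality, and without measurability of a selected hypothesis. *)
Require Import Defs.
From HB Require Import structures.
From mathcomp Require Import all_boot all_order all_algebra.
From mathcomp Require Import all_classical all_reals all_analysis.
From mathcomp Require Import Rstruct Rstruct_topology.
From mathcomp Require Import measurable_realfun ring lra zify.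
Set Implicit Arguments.
Unset Strict Implicit.
Unset Printing Implicit Defensive.
Import Order.TTheory GRing.Theory Num.Theory.
Import numFieldNormedType.Exports.
Local Open Scope classical_set_scope.
Local Open Scope ring_scope.

(** * Iterated integrals *)

Section iterated_integral.
Context {R : realType} {n : nat}.
Implicit Types (y : 'I_n -> R) (k : 'I_n).

(** The generators of [prod_measurable], named so that [g_sigma_algebraType] turns the sample space
    into a measurable type on which [estimator] says that each coordinate is measurable. *)
Definition coord_preimages : set (set ('I_n -> R)) :=
  [set A | exists i : 'I_n, exists B : set R,
     measurable B /\ A = (fun y : 'I_n -> R => y i) @^-1` B].

Let T : measurableType _ := g_sigma_algebraType coord_preimages.

Definition coord_update k y (t : R) : 'I_n -> R :=
  fun j => if j == k then t else y j.

Lemma measurable_coord k : measurable_fun setT (fun y : T => y k).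
Proof.
move=> _ B mB; rewrite setTI; apply: sub_sigma_algebra.
by exists k, B.
Qed.

(** Joint measurability in the point and the new coordinate is what lets Tonelli make inner
    integrals measurable in the remaining coordinates. It is checked on generators. *)
Lemma measurable_coord_update k :
  measurable_fun setT (fun z : T * R => coord_update k z.1 z.2 : T).
Proof.
refine (@measurability _ _ _ T setT _ coord_preimages erefl _) => _ [_ [i [B [mB ->]]] <-].
rewrite setTI /preimage /coord_update /=.
case: eqP => _.
  rewrite [X in measurable X](_ : _ = setT `&` snd @^-1` B); last by rewrite setTI.
  exact: measurable_snd.
rewrite [X in measurable X]
  (_ : _ = setT `&` ((fun y : T => y i) \o fst) @^-1` B); last by rewrite setTI.
by apply: (measurableT_comp (measurable_coord i) measurable_fst).
Qed.

Variable nu : {measure set R -> \bar R}.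
Hypothesis nuS : sigma_finite setT nu.

Lemma measurable_integral_update k (G : T -> \bar R) :
  measurable_fun setT G -> (forall y, 0 <= G y)%E ->
  measurable_fun setT (fun y : T => \int[nu]_t G (coord_update k y t))%E.
Proof.
move=> mG G0.
(* [nu] is a bare measure; its sigma-finiteness is packed into a structure here so that Tonelli
   applies. *)
pose sfin := isSFinite.Build _ _ _ (nu : set R -> \bar R)
  (sfinite_measure_sigma_finite nuS).
pose sigfin := isSigmaFinite.Build _ _ _ (nu : set R -> \bar R) nuS.
pose nu' := HB.pack_for (SigmaFiniteMeasure.type R R) (Measure.sort nu) sfin sigfin.
apply: (@measurable_fun_fubini_tonelli_F _ _ T R R nu'
  (fun z : T * R => G (coord_update k z.1 z.2))) => [|z]; last exact: G0.
exact: measurableT_comp mG (measurable_coord_update k).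
Qed.

Lemma measurable_update_section k y (G : T -> \bar R) :
  measurable_fun setT G -> measurable_fun setT (fun t => G (coord_update k y t)).
Proof.
move=> mG.
have mk := measurableT_comp mG (measurable_coord_update k).
exact: (measurableT_comp mk (@pair1_measurable _ _ T R y)).
Qed.

Lemma iint_ge0 s (G : T -> \bar R) y :
  (forall y, 0 <= G y)%E -> (0 <= iint nu s G y)%E.
Proof.
move=> G0; elim: s y => [|k s ih] y /=; first exact: G0.
by apply: integral_ge0 => t _; exact: ih.
Qed.

Lemma measurable_iint s (G : T -> \bar R) :
  measurable_fun setT G -> (forall y, 0 <= G y)%E ->
  measurable_fun setT (iint nu s G : T -> \bar R).
Proof.
move=> mG G0; elim: s => [//|k s ih] /=.
by apply: measurable_integral_update => // y; exact: iint_ge0.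
Qed.

Lemma measurable_iint_section s (G : T -> \bar R) k y :
  measurable_fun setT G -> (forall y, 0 <= G y)%E ->
  measurable_fun setT
    (fun t => iint nu s G (fun j => if j == k then t else y j)).
Proof.
move=> mG G0.
exact: (measurable_update_section (G := iint nu s G) k y (measurable_iint s mG G0)).
Qed.

Lemma le_iint s (G H : T -> \bar R) y :
  measurable_fun setT G -> measurable_fun setT H -> (forall y, 0 <= G y)%E ->
  (forall y, G y <= H y)%E -> (iint nu s G y <= iint nu s H y)%E.
Proof.
move=> mG mH G0 GH.
have H0 z : (0 <= H z)%E := le_trans (G0 z) (GH z).
elim: s y => [|k s ih] y /=; first exact: GH.
apply: ge0_le_integral => //.
- by move=> t _; exact: iint_ge0.
- exact: measurable_iint_section.
- exact: measurable_iint_section.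
Qed.

Lemma iintD s (G H : T -> \bar R) y :
  measurable_fun setT G -> measurable_fun setT H ->
  (forall y, 0 <= G y)%E -> (forall y, 0 <= H y)%E ->
  iint nu s (fun z => G z + H z)%E y = (iint nu s G y + iint nu s H y)%E.
Proof.
move=> mG mH G0 H0; elim: s y => [//|k s ih] y /=.
under eq_integral do rewrite ih.
rewrite ge0_integralD //.
- by move=> t _; exact: iint_ge0.
- exact: measurable_iint_section.
- by move=> t _; exact: iint_ge0.
- exact: measurable_iint_section.
Qed.

Lemma iint_sum (I : Type) (r : seq I) s (G : I -> T -> \bar R) y :
  (forall i, measurable_fun setT (G i)) -> (forall i y, 0 <= G i y)%E ->
  iint nu s (fun z => \sum_(i <- r) G i z)%E y = (\sum_(i <- r) iint nu s (G i) y)%E.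
Proof.
move=> mG G0; elim: s y => [//|k s ih] y /=.
under eq_integral do rewrite ih.
rewrite ge0_integral_sum //.
- move=> i; exact: measurable_iint_section.
- by move=> i t _; exact: iint_ge0.
Qed.

Lemma iintZ s (G : T -> \bar R) (x : R) y :
  measurable_fun setT G -> (forall y, 0 <= G y)%E -> 0 <= x ->
  iint nu s (fun z => x%:E * G z)%E y = (x%:E * iint nu s G y)%E.
Proof.
move=> mG G0 x0; elim: s y => [//|k s ih] y /=.
under eq_integral do rewrite ih.
rewrite ge0_integralZl //.
- exact: measurable_iint_section.
- by move=> t _; exact: iint_ge0.
Qed.

Lemma measurable_prod_coord (f : 'I_n -> R -> R) :
  (forall i, measurable_fun setT (f i)) ->
  measurable_fun setT (fun y : T => \prod_(i < n) f i (y i)).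
Proof.
move=> mf; apply: measurable_prod => i _.
exact: measurableT_comp (mf i) (measurable_coord i).
Qed.

(** Integrating out a coordinate replaces its factor by 1. As [s] has no repetition, the factor at
    [k] is still present when its turn comes. *)
Lemma iint_prod_density s (f : 'I_n -> R -> R) y :
  uniq s -> (forall i, measurable_fun setT (f i)) -> (forall i t, 0 <= f i t) ->
  (forall i, \int[nu]_t (f i t)%:E = 1)%E ->
  iint nu s (fun z => (\prod_(i < n) f i (z i))%:E) y =
  (\prod_(i < n | i \notin s) f i (y i))%:E.
Proof.
move=> + mf f0 f1; elim: s y => [|k s ih] y /=.
  by move=> _; congr EFin; apply: eq_bigl => i.
case/andP => ks us.
pose P := \prod_(i < n | i \notin k :: s) f i (y i).
transitivity (\int[nu]_t (P%:E * (f k t)%:E))%E.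
  apply: eq_integral => t _; rewrite ih// (bigD1 k)//= eqxx mulrC EFinM.
  congr (_%:E * _)%E; apply: eq_big => i; first by rewrite inE negb_or andbC.
  by case/andP => _ /negPf ->.
rewrite ge0_integralZl//.
- by rewrite f1 mule1.
- by have /measurable_EFinP := mf k.
- by move=> t _; rewrite lee_fin.
- by rewrite lee_fin prodr_ge0.
Qed.

End iterated_integral.

(** * Second-order bounds and the log-partition function *)

Section second_order.
Context {R : realType}.
Implicit Types (f b : R -> R).

Lemma MVT_derivable f x y : (forall t, derivable f t 1) -> x < y ->
  exists2 c, x < c < y & f y - f x = (derive1 f) c * (y - x).
Proof.
move=> df xy.
have [||c cxy ->] := @MVT R f (derive1 f) x y xy.
- by move=> t _; rewrite derive1E; exact: derivableP.
- apply: derivable_within_continuous => t _; exact: df.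
- by exists c.
Qed.

(** The mean value theorem is used twice: for [h], which is [b] minus its tangent at [x] and the
    quadratic, and then for [b'] between [x] and the point obtained. *)
Lemma taylor2_ge b x y (L : R) :
  (forall t, derivable b t 1 /\ derivable (derive1 b) t 1) ->
  (forall t, Num.min x y <= t <= Num.max x y -> L <= derive1 (derive1 b) t) ->
  L / 2 * (y - x) ^+ 2 <= b y - b x - (derive1 b) x * (y - x).
Proof.
move=> db bL.
pose h t := b t - (derive1 b) x * t - L / 2 * (t - x) ^+ 2.
have dh (t : R) : is_derive t 1 h ((derive1 b) t - (derive1 b) x - L * (t - x)).
  have bt : is_derive t 1 b ((derive1 b) t).
    by rewrite derive1E; apply: derivableP; case: (db t).
  rewrite /h; apply: is_derive_eq; rewrite /GRing.scale /=; lra.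
have dhE t : (derive1 h) t = (derive1 b) t - (derive1 b) x - L * (t - x).
  by rewrite derive1E; apply: derive_val.
have dhd (t : R) : derivable h t 1 by case: (dh t).
have db2 (t : R) : derivable (derive1 b) t 1 by case: (db t).
have [xy|yx|->] := ltgtP x y; last by rewrite !subrr expr0n !mulr0 subrr.
- have [c /andP[xc cy] hc] := MVT_derivable dhd xy.
  have [e /andP[xe ec] be] := MVT_derivable db2 xc.
  have eL : L <= derive1 (derive1 b) e.
    by apply: bL; rewrite minEle maxEle (ltW xy) (ltW xe)/= ltW// (lt_trans ec).
  move: hc; rewrite dhE be /h => hc.
  have : 0 <= (derive1 (derive1 b) e - L) * (c - x) * (y - x).
    by rewrite !mulr_ge0 ?subr_ge0// ltW.
  nra.
- have [c /andP[yc cx] hc] := MVT_derivable dhd yx.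
  have [e /andP[ce ex] be] := MVT_derivable db2 cx.
  have eL : L <= derive1 (derive1 b) e.
    by apply: bL; rewrite (min_idPr (ltW yx)) (max_idPl (ltW yx)) (ltW ex) andbT ltW// (lt_trans yc).
  have {}be : (derive1 b) c = (derive1 b) x - derive1 (derive1 b) e * (x - c) by lra.
  move: hc; rewrite dhE be /h => hc.
  have : 0 <= (derive1 (derive1 b) e - L) * (x - c) * (x - y).
    by rewrite !mulr_ge0 ?subr_ge0// ltW.
  nra.
Qed.

(** Taylor bounds for [- b] from [t] to [2 * t] and from [t] to 0 are added; the first-order terms
    cancel. *)
Lemma second_difference_le b (U t : R) :
  (forall t, derivable b t 1 /\ derivable (derive1 b) t 1) ->
  (forall t, derive1 (derive1 b) t <= U) ->
  b (2 * t) - 2 * b t + b 0 <= U * t ^+ 2.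
Proof.
move=> db bU.
have dN x : (derive1 (- b)) x = - (derive1 b) x.
  by rewrite !derive1E deriveN//; case: (db x).
have dNE : (derive1 (- b)) = - (derive1 b) by apply/funext.
have dNb (x : R) : derivable (- b) x 1 /\ derivable (derive1 (- b)) x 1.
  by case: (db x) => ? ?; rewrite dNE; split; exact: derivableN.
have N2 x : - U <= derive1 (derive1 (- b)) x.
  by rewrite dNE derive1E deriveN ?lerN2 -?derive1E//; case: (db x).
have := @taylor2_ge (- b) t (2 * t) (- U) dNb (fun z _ => N2 z).
have := @taylor2_ge (- b) t 0 (- U) dNb (fun z _ => N2 z).
rewrite dN !fctE; nra.
Qed.

(** The derivative at [x] in direction [y - x] is a limit of right difference quotients, each at
    most [b y - b x] by convexity. *)
Lemma convex_tangent b x y :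
  (forall t, derivable b t 1) ->
  (forall t u v, 0 <= t <= 1 -> b (t * u + (1 - t) * v) <= t * b u + (1 - t) * b v) ->
  0 <= b y - b x - (derive1 b) x * (y - x).
Proof.
move=> db bconv.
have dif : differentiable b x by apply/derivable1_diffP.
have dE : 'D_(y - x) b x = derive1 b x * (y - x).
  rewrite deriveE// derive1E deriveE// mulrC -[X in 'd b x X](mulr1 (y - x)).
  exact: linearZ.
have cv := cvg_dnbhs_at_right (@diff_derivable _ _ _ b x (y - x) dif).
rewrite -/(derive b x (y - x)) dE in cv.
rewrite subr_ge0; apply: (cvgr_to_le cv); near=> h.
have h0 : 0 < h by near: h; exact: nbhs_right_gt.
have h1 : h <= 1 by near: h; exact: nbhs_right_ltW.
rewrite /GRing.scale /= ler_pdivrMl//.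
have -> : h * (y - x) + x = h * y + (1 - h) * x by ring.
have : 0 <= h <= 1 by rewrite h1 ltW.
by move=> /(bconv h y x); lra.
Unshelve. all: by end_near. Qed.

(* [z] need not lie in [Theta]: either it lies between [x] and [y], or one of the
   two points separates it from the other and convexity reduces to that point. *)
Lemma bregman_pair_ge b (Theta : set R) (L x y z : R) :
  (forall t, derivable b t 1 /\ derivable (derive1 b) t 1) ->
  (forall u v, 0 <= b v - b u - (derive1 b) u * (v - u)) ->
  is_interval Theta -> Theta x -> Theta y -> 0 <= L ->
  (forall t, Theta t -> L <= derive1 (derive1 b) t) ->
  L / 4 * (x - y) ^+ 2 <=
    (b z - b x - (derive1 b) x * (z - x)) + (b z - b y - (derive1 b) y * (z - y)).
Proof.
move=> db bconv itvT Tx Ty L0 bL.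
wlog xy : x y Tx Ty / x <= y => [hw|].
  have [xy|/ltW yx] := leP x y; first exact: hw.
  by rewrite [leRHS]addrC (_ : (x - y) ^+ 2 = (y - x) ^+ 2); [exact: hw|ring].
have Tbetween u v t : Theta u -> Theta v -> Num.min u v <= t <= Num.max u v -> Theta t.
  move=> Tu Tv; case: (leP u v) => _ h; first exact: itvT h.
  exact: (itvT v u).
have tay u v : Theta u -> Theta v ->
    L / 2 * (v - u) ^+ 2 <= b v - b u - (derive1 b) u * (v - u).
  by move=> Tu Tv; apply: taylor2_ge => // t ht; apply/bL/(Tbetween u v).
have db_mono : derive1 b x <= derive1 b y.
  move: xy; rewrite le_eqVlt => /orP[/eqP->//|xy].
  rewrite -subr_ge0 -(pmulr_lge0 _ (_ : 0 < y - x)) ?subr_gt0//.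
  have := bconv x y; have := bconv y x; lra.
have Lxy : 0 <= L * (x - y) ^+ 2 by rewrite mulr_ge0 ?sqr_ge0.
(* Three-point identity: the Bregman term of [z] at [y] is that of [x] at [y], plus that of [z] at
   [x], plus [(b' y - b' x) * (x - z)]. The case [y <= z] is symmetric. *)
have [zx|xz] := leP z x.
  have : 0 <= (derive1 b y - derive1 b x) * (x - z) by rewrite mulr_ge0 ?subr_ge0.
  have := tay _ _ Ty Tx; have := bconv x z; lra.
have [yz|zy] := leP y z.
  have : 0 <= (derive1 b y - derive1 b x) * (z - y) by rewrite mulr_ge0 ?subr_ge0.
  have := tay _ _ Tx Ty; have := bconv y z; lra.
(* Between the two points, [2 * ((x - z)^2 + (y - z)^2) = (x - y)^2 + (x + y - 2 * z)^2]. *)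
have := mulr_ge0 L0 (sqr_ge0 (x + y - 2 * z)).
have Tz : Theta z by apply: (itvT x y) => //; rewrite (ltW xz) (ltW zy).
have := tay _ _ Tx Tz; have := tay _ _ Ty Tz; lra.
Qed.

Lemma expR_convex (t u v : R) : 0 <= t <= 1 ->
  expR (t * u + (1 - t) * v) <= t * expR u + (1 - t) * expR v.
Proof.
case/andP => t0 t1; set m := t * u + _.
have tangent w : expR m * (1 + (w - m)) <= expR w.
  have -> : expR w = expR m * expR (w - m) by rewrite -exp.expRD addrC subrK.
  by rewrite ler_wpM2l ?expR_ge0 ?expR_ge1Dx.
have := ler_wpM2l t0 (tangent u).
have : 0 <= 1 - t by lra.
move=> /ler_wpM2l /(_ _ _ (tangent v)).
suff : expR m = t * (expR m * (1 + (u - m))) + (1 - t) * (expR m * (1 + (v - m))).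
  lra.
rewrite /m; ring.
Qed.

End second_order.

Section exponential_family.
Context {R : realType} (nu : {measure set R -> \bar R}) (a : R) (b c : R -> R).
Hypotheses (a_gt0 : 0 < a) (mc : measurable_fun setT c).
Hypothesis dens1 : forall t, (\int[nu]_y (dens a b c t y)%:E)%E = 1%E.

Lemma dens_ge0 t y : 0 <= dens a b c t y.
Proof. exact: expR_ge0. Qed.

Lemma measurable_dens t : measurable_fun setT (dens a b c t).
Proof.
apply: measurableT_comp; first exact: measurable_expR.
apply: measurable_funD => //; apply: measurable_funM => //.
by apply: measurable_funB => //; apply: measurable_funM.
Qed.

(** Convexity of exp gives [expR (- E) * f_w <= t * f_u + (1 - t) * f_v] pointwise. All three
    densities integrate to 1, so [expR (- E) <= 1]. This yields convexity on the whole line, whereas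
    [b''] is bounded below only on [Theta]. *)
Lemma log_partition_convex (t u v : R) : 0 <= t <= 1 ->
  b (t * u + (1 - t) * v) <= t * b u + (1 - t) * b v.
Proof.
move=> t01; have /andP[t0 t1] := t01; have s0 : 0 <= 1 - t by lra.
pose w := t * u + (1 - t) * v.
pose E := (t * b u + (1 - t) * b v - b w) / a.
have mE z : measurable_fun setT (fun y => (dens a b c z y)%:E).
  by have /measurable_EFinP := measurable_dens z.
have E0 z y : (0 <= (dens a b c z y)%:E)%E by rewrite lee_fin dens_ge0.
have : ((expR (- E))%:E <= 1)%E.
  have -> : (expR (- E))%:E = (\int[nu]_y ((expR (- E))%:E * (dens a b c w y)%:E))%E.
    by rewrite ge0_integralZl ?dens1 ?mule1// lee_fin expR_ge0.
  have <- : (\int[nu]_y (t%:E * (dens a b c u y)%:E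
                       + (1 - t)%:E * (dens a b c v y)%:E) = 1)%E.
    rewrite ge0_integralD//.
    - by rewrite !ge0_integralZl ?lee_fin// !dens1 !mule1 -EFinD addrC subrK.
    - by move=> y _; rewrite mule_ge0 ?lee_fin ?dens_ge0.
    - exact: measurable_funeM.
    - by move=> y _; rewrite mule_ge0 ?lee_fin ?dens_ge0.
    - exact: measurable_funeM.
  apply: ge0_le_integral => //.
  - by move=> y _; rewrite mule_ge0 ?lee_fin ?expR_ge0 ?dens_ge0.
  - exact: measurable_funeM.
  - by apply: emeasurable_funD; exact: measurable_funeM.
  - move=> y _; rewrite -!EFinM -EFinD lee_fin /dens -exp.expRD.
    apply: le_trans (expR_convex _ _ t01); rewrite ler_expR.
    rewrite le_eqVlt; apply/orP; left; apply/eqP; rewrite /E /w; field.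
    by rewrite gt_eqF.
rewrite lee_fin -[leRHS]exp.expR0 ler_expR oppr_le0 /E pmulr_lge0 ?invr_gt0//.
by rewrite subr_ge0.
Qed.

End exponential_family.

(** * Sparse eigenvalues *)

Section sparse_eigenvalues.
Context {R : realType}.

Lemma l0normE p (beta : 'cV[R]_p) :
  l0norm beta = #|[set j | beta j 0 != 0]%SET|.
Proof.
by apply: eq_card => j; rewrite finset.in_set; apply/idP/idP => [/set_mem|/mem_set].
Qed.

Lemma sqnorm_ge0 p (v : 'cV[R]_p) : 0 <= sqnorm v.
Proof. by apply: sumr_ge0 => i _; exact: sqr_ge0. Qed.

Lemma sqr_le_sqnorm p (v : 'cV[R]_p) j : v j 0 ^+ 2 <= sqnorm v.
Proof.
by rewrite /sqnorm (bigD1 j)//= lerDl sumr_ge0// => i _; exact: sqr_ge0.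
Qed.

Lemma sqnorm_gt0 p (v : 'cV[R]_p) : (0 < l0norm v)%N -> 0 < sqnorm v.
Proof.
rewrite l0normE card_gt0 => /set0Pn[j]; rewrite inE => vj.
by apply: lt_le_trans (sqr_le_sqnorm v j); rewrite exprn_even_gt0.
Qed.

Lemma l0norm_eq0 p (v : 'cV[R]_p) : l0norm v = 0%N -> v = 0.
Proof.
rewrite l0normE => /eqP; rewrite cards_eq0 => /eqP/setP v0.
apply/colP => j; have := v0 j; rewrite !inE mxE => /negbFE/eqP ->.
by [].
Qed.

Lemma sqr_sum_le p (u : 'I_p -> R) :
  (\sum_j u j) ^+ 2 <= p%:R * \sum_j u j ^+ 2.
Proof.
rewrite expr2 big_distrlr /=.
apply: (@le_trans _ _ (\sum_(i < p) \sum_(j < p) (u i ^+ 2 / 2 + u j ^+ 2 / 2))).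
  apply: ler_sum => i _; apply: ler_sum => j _.
  have := sqr_ge0 (u i - u j); lra.
rewrite [leLHS](eq_bigr (fun i => p%:R / 2 * u i ^+ 2 + (\sum_j u j ^+ 2) / 2)).
  by rewrite big_split /= sumr_const card_ord -mulr_sumr -mulr_natl; lra.
move=> i _; rewrite big_split /= sumr_const card_ord -mulr_natl mulr_suml; lra.
Qed.

Context {n p : nat} (X : 'M[R]_(n, p)).
Implicit Types (k : nat) (beta : 'cV[R]_p).

(** Cauchy-Schwarz on each row; it makes [phi_max] a genuine supremum. *)
Lemma ratio_set_ubound k : has_ubound (ratio_set X k).
Proof.
exists (\sum_(i < n) p%:R * \sum_(j < p) X i j ^+ 2) => _ [beta /andP[b1 _] <-].
rewrite ler_pdivrMr ?sqnorm_gt0// mulr_suml; apply: ler_sum => i _.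
rewrite mxE; apply: le_trans (sqr_sum_le _) _.
rewrite -mulrA ler_wpM2l// mulr_suml; apply: ler_sum => j _.
by rewrite exprMn ler_wpM2l ?sqr_ge0// sqr_le_sqnorm.
Qed.

Lemma ratio_set_ge0 k : lbound (ratio_set X k) 0.
Proof. by move=> _ [beta _ <-]; rewrite divr_ge0 ?sqnorm_ge0. Qed.

Lemma phi_min_ge0 k : 0 <= phi_min X k.
Proof.
rewrite /phi_min; have [->|ne] := eqVneq (ratio_set X k) set0; first by rewrite inf0.
by apply: lb_le_inf; [exact/set0P|exact: ratio_set_ge0].
Qed.

Lemma phi_max_ge0 k : 0 <= phi_max X k.
Proof.
rewrite /phi_max; have [->|/set0P[r Xr]] := eqVneq (ratio_set X k) set0.
  by rewrite sup0.
exact: le_trans (ratio_set_ge0 Xr) (ub_le_sup (ratio_set_ubound k) Xr).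
Qed.

Lemma sqnorm0 m : sqnorm (0 : 'cV[R]_m) = 0.
Proof. by rewrite /sqnorm big1// => i _; rewrite mxE expr0n. Qed.

Lemma sqnorm_mulmx_le k beta : (l0norm beta <= k)%N ->
  sqnorm (X *m beta) <= phi_max X k * sqnorm beta.
Proof.
move=> bk; have [/l0norm_eq0 ->|b0] := posnP (l0norm beta).
  by rewrite mulmx0 !sqnorm0 mulr0.
rewrite -ler_pdivrMr ?sqnorm_gt0//; apply: (ub_le_sup (ratio_set_ubound k)).
by exists beta => //=; rewrite b0.
Qed.

Lemma sqnorm_mulmx_ge k beta : (l0norm beta <= k)%N ->
  phi_min X k * sqnorm beta <= sqnorm (X *m beta).
Proof.
move=> bk; have [/l0norm_eq0 ->|b0] := posnP (l0norm beta).
  by rewrite mulmx0 !sqnorm0 mulr0.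
rewrite -ler_pdivlMr ?sqnorm_gt0//.
apply: ge_inf; first by exists 0; exact: ratio_set_ge0.
by exists beta => //=; rewrite b0.
Qed.

(** The coordinate vector of a nonzero column is 1-sparse and has a nonzero image. *)
Lemma phi_max_gt0 k : X != 0 -> (0 < k)%N -> 0 < phi_max X k.
Proof.
move=> X0 k0.
have [i [j Xij]] : exists i j, X i j != 0.
  apply: contra_neqP X0 => h; apply/matrixP => i j; rewrite mxE.
  by apply: contra_notP h => /eqP Xij; exists i, j.
pose e : 'cV[R]_p := delta_mx j 0.
have el0 : l0norm e = 1%N.
  rewrite l0normE -[RHS](cards1 j); apply: eq_card => l; rewrite !inE mxE eqxx andbT.
  by case: (l == j); rewrite ?oner_eq0 ?eqxx.
have XE : (X *m e) i 0 = X i j by rewrite -colE mxE.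
have : 0 < sqnorm (X *m e).
  apply: lt_le_trans (sqr_le_sqnorm _ i).
  by rewrite XE exprn_even_gt0.
move=> /lt_le_trans /(_ (@sqnorm_mulmx_le k e _)).
by rewrite el0 => /(_ k0); rewrite pmulr_lgt0// sqnorm_gt0 ?el0.
Qed.

End sparse_eigenvalues.

(** * Vectors constant on their support *)

Section indicator.
Context {R : realType} {p : nat}.
Implicit Types (S : {set 'I_p}) (C : R).

Definition indic_col C S : 'cV[R]_p := \col_j (if j \in S then C else 0).

Lemma sqnorm_indic_col C S : sqnorm (indic_col C S) = C ^+ 2 * #|S|%:R.
Proof.
rewrite mulr_natr -sumr_const [RHS]big_mkcond; apply: eq_bigr => j _.
by rewrite mxE; case: ifP => _; rewrite ?expr0n.
Qed.

Lemma l0norm_indic_col C S : (l0norm (indic_col C S) <= #|S|)%N.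
Proof.
rewrite l0normE; apply/subset_leq_card/fintype.subsetP => j; rewrite inE mxE.
by case: ifP; rewrite ?eqxx.
Qed.

Lemma sqnorm_indic_colB C S S' :
  sqnorm (indic_col C S - indic_col C S') =
  C ^+ 2 * #|(S :\: S') :|: (S' :\: S)|%:R.
Proof.
rewrite mulr_natr -sumr_const [RHS]big_mkcond; apply: eq_bigr => j _.
rewrite !mxE !inE; case: (j \in S); case: (j \in S') => /=;
  by rewrite ?subrr ?sub0r ?subr0 ?sqrrN ?expr0n.
Qed.

Lemma l0norm_indic_colB C S S' :
  (l0norm (indic_col C S - indic_col C S') <= #|S :|: S'|)%N.
Proof.
rewrite l0normE; apply/subset_leq_card/fintype.subsetP => j; rewrite !inE !mxE.
by case: (j \in S); case: (j \in S') => //=; rewrite subrr eqxx.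
Qed.

End indicator.

(** * Hamming balls *)

Section hamming.
Context {R : realFieldType} {q m : nat}.
Implicit Types (f g : {ffun 'I_q -> 'I_m}) (S : {set {ffun 'I_q -> 'I_m}}).

Definition hamming f g : nat := #|[set i | f i != g i]%SET|.

(** The generating function of the number of agreements with [g] factors over positions: one letter
    contributes [w], the other [m - 1] contribute 1. *)
Lemma sum_expr_agreement (w : R) g :
  \sum_f w ^+ (q - hamming f g) = (w + m.-1%:R) ^+ q.
Proof.
transitivity (\sum_(f : {ffun 'I_q -> 'I_m}) \prod_i (if f i == g i then w else 1)).
  apply: eq_bigr => f _; rewrite -big_mkcond /= prodr_const; congr (_ ^+ _).
  rewrite -[X in (X - _)%N](card_ord q) -(cardsC [set i | f i != g i]%SET) addKn.
  by apply: eq_card => i; rewrite !inE negbK.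
rewrite -(bigA_distr_bigA (fun i j => if j == g i then w else 1)).
rewrite (eq_bigr (fun=> w + m.-1%:R)) ?prodr_const ?card_ord// => i _.
rewrite (bigD1 (g i))//= eqxx; congr (_ + _).
rewrite (eq_bigr (fun=> 1)) => [|j /negPf ->//].
by rewrite sumr_const cardC1 card_ord.
Qed.

(* With [w = m + 1], the sum above is [(2 m)^q], while every term indexed by the
   ball is at least [w^(15 q / 16)]; hence a ball of radius [q / 16] contains a
   fraction of at most [(2 / w^(15 / 16))^q] of the words. *)
Lemma card_hamming_ball (v : R) S : (1 < m)%N -> (0 < q)%N ->
  0 < v -> v ^+ 16 = m.+1%:R ->
  {in S &, forall f g, (16 * hamming f g <= q)%N} ->
  v ^+ q * #|S|%:R <= 4 / 5 * m%:R ^+ q.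
Proof.
move=> m1 q0 v0 vE Sball.
have v1 : 1 <= v.
  rewrite leNgt; apply/negP => v1.
  have : v ^+ 16 <= 1 by rewrite exprn_ile1// ltW.
  by rewrite vE lern1 ltnS leqn0; case: (m) m1.
have m_gt0 : 0 < m%:R :> R by rewrite ltr0n ltnW.
have [->|[g gS]] := set_0Vmem S.
  by rewrite cards0 mulr0 mulr_ge0// exprn_ge0// ltW.
have cardS : v ^+ (15 * q) * #|S|%:R <= (2 * m%:R) ^+ q.
  have -> : 2 * m%:R = v ^+ 16 + m.-1%:R :> R.
    by rewrite vE -natrD -natrM; congr (_%:R); lia.
  rewrite -(sum_expr_agreement _ g) mulr_natr -sumr_const.
  rewrite [leLHS]big_mkcond; apply: ler_sum => f _.
  case: ifP => [fS|_]; last by rewrite exprn_ge0// exprn_ge0// ltW.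
  rewrite -exprM ler_weXn2l//; have := Sball _ _ fS gS.
  lia.
(* Taking eighth powers, [(v^14)^8 = (m + 1)^7 >= 3^7 >= (5 / 2)^8]. *)
have v14 : 5 / 2 <= v ^+ 14.
  rewrite -(@ler_pXn2r _ 8)// ?nnegrE ?divr_ge0 ?exprn_ge0 ?(ltW v0)//.
  rewrite -exprM (_ : (14 * 8)%N = (16 * 7)%N)// exprM vE.
  apply: (@le_trans _ _ (3 ^+ 7)); first lra.
  by rewrite ler_pXn2r ?nnegrE ?ler0n// ler_nat.
(* With [v^q * v^(14 q) = v^(15 q)], what remains is [2^q = (4 / 5)^q * (5 / 2)^q] and
   [(4 / 5)^q <= 4 / 5]. *)
rewrite -(ler_pM2r (_ : 0 < (5 / 2) ^+ q)) ?exprn_gt0 ?divr_gt0//.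
apply: (@le_trans _ _ (v ^+ q * #|S|%:R * v ^+ 14 ^+ q)).
  rewrite ler_wpM2l ?mulr_ge0 ?exprn_ge0 ?(ltW v0)//.
  by rewrite ler_pXn2r ?nnegrE ?divr_ge0 ?exprn_ge0 ?(ltW v0).
apply: (@le_trans _ _ (2 ^+ q * m%:R ^+ q)).
  rewrite -exprMn mulrAC -exprM -exprD (_ : (q + 14 * q)%N = (15 * q)%N)//; lia.
rewrite mulrAC ler_wpM2r ?exprn_ge0 ?(ltW m_gt0)//.
rewrite (_ : 2 ^+ q = (4 / 5) ^+ q * (5 / 2) ^+ q); last first.
  by rewrite -exprMn; congr (_ ^+ _); lra.
rewrite ler_wpM2r ?exprn_ge0 ?divr_ge0//.
rewrite -[leRHS]expr1 ler_wiXn2l//; lra.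
Qed.

End hamming.

(** * Bayes risk at a fixed observation *)

Section pointwise.
Context {R : realFieldType} {F : finType}.

(* A Bayes-risk bound at a fixed observation: [P f], [P2 f] and [P0] are the values
   of the densities at [theta_f], [2 theta_f] and [0], and [K] bounds the second
   moment of the likelihood ratio of [P f] to [P0]. *)
Lemma pointwise_risk_ge (P P2 g : F -> R) (P0 K s : R) :
  0 <= s -> 0 <= K -> 0 <= P0 ->
  (forall f, 0 <= P f) -> (forall f, 0 <= P2 f) -> (forall f, 0 <= g f) ->
  (forall f, P f ^+ 2 <= K * (P2 f * P0)) ->
  K * #|[set f | g f < s]%SET|%:R <= 4 / 5 * #|F|%:R ->
  s * \sum_f P f <=
    \sum_f P f * g f + 9 / 20 * s * \sum_f P2 f + 4 / 9 * s * #|F|%:R * P0.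
Proof.
move=> s0 K0 P00 Pge P2ge gge PK card.
pose S := [set f | g f < s]%SET.
(* AM-GM: the weights satisfy [4 * (9 / 20) * (5 / 9) = 1]. *)
have bound f : P f <= 9 / 20 * P2 f + 5 / 9 * K * P0.
  have r0 : 0 <= 9 / 20 * P2 f + 5 / 9 * K * P0.
    by rewrite addr_ge0 ?mulr_ge0// divr_ge0.
  rewrite -(@ler_pXn2r _ 2)// ?nnegrE//; apply: le_trans (PK f) _.
  have := sqr_ge0 (9 / 20 * P2 f - 5 / 9 * K * P0); lra.
(* Outside [S] the loss itself pays for [s * P f]; inside [S] the AM-GM bound does. Summing over [S]
   with the cardinality hypothesis turns [5 / 9] into [4 / 9]. *)
have term f : s * P f <=
    P f * g f + 9 / 20 * s * P2 f + (if f \in S then s * (5 / 9 * K * P0) else 0).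
  rewrite inE; case: ltP => gs.
    have := mulr_ge0 (Pge f) (gge f); have := ler_wpM2l s0 (bound f); lra.
  have := ler_wpM2r (Pge f) gs; have := mulr_ge0 s0 (P2ge f); lra.
rewrite mulr_sumr; apply: le_trans.
  by apply: ler_sum => f _; exact: term.
rewrite !big_split /= -!mulr_sumr lerD2l -big_mkcond sumr_const -mulr_natr.
have := ler_wpM2l (mulr_ge0 s0 P00) card.
rewrite -/S; lra.
Qed.

End pointwise.

(** * The minimax bound *)

Section minimax.
Context {R : realType} {n p : nat} (X : 'M[R]_(n, p)).
Context (nu : {measure set R -> \bar R}) (a : R) (b c : R -> R).
Context (Theta : set R) (L U : R).
Hypothesis nu_sigma_finite : sigma_finite setT nu.
Hypothesis mc : measurable_fun setT c.
Hypothesis dens1 : forall t, (\int[nu]_y (dens a b c t y)%:E)%E = 1%E.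
Hypothesis Theta_itv : is_interval Theta.
Hypothesis db : forall t, derivable b t 1 /\ derivable (derive1 b) t 1.
Hypotheses (L_gt0 : 0 < L) (U_gt0 : 0 < U).
Hypothesis b2_le : forall t, derive1 (derive1 b) t <= U.
Hypothesis b2_ge : forall t, Theta t -> L <= derive1 (derive1 b) t.
Hypothesis a_gt0 : 0 < a.

(** Required on the whole line, since an estimator may take values outside [Theta]. *)
Let bregman_ge0 u v : 0 <= b v - b u - derive1 b u * (v - u).
Proof.
apply: convex_tangent => [t|]; first by case: (db t).
exact: log_partition_convex a_gt0 mc dens1.
Qed.

Let joint (theta y : 'I_n -> R) : R := \prod_(i < n) dens a b c (theta i) (y i).

Let joint_ge0 theta y : 0 <= joint theta y.
Proof. by apply: prodr_ge0 => i _; exact: dens_ge0. Qed.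

(* [f_theta^2 / f_0] is [f_(2 theta)] up to a constant factor, which is the second
   moment of the likelihood ratio. *)
Lemma joint_sqr_le (theta y : 'I_n -> R) (D : R) :
  U / a * \sum_(i < n) theta i ^+ 2 <= D ->
  joint theta y ^+ 2 <=
    expR D * (joint (fun i => 2 * theta i) y * joint (fun=> 0) y).
Proof.
move=> hD.
pose E i := (b (2 * theta i) - 2 * b (theta i) + b 0) / a.
have -> : joint theta y ^+ 2 =
    expR (\sum_(i < n) E i) * (joint (fun i => 2 * theta i) y * joint (fun=> 0) y).
  rewrite expR_sum /joint -!big_split /= expr2 -big_split /=.
  apply: eq_bigr => i _; rewrite /dens /E -!exp.expRD; congr expR.
  by field; rewrite gt_eqF.
rewrite ler_wpM2r ?mulr_ge0// ler_expR; apply: le_trans hD.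
rewrite mulr_sumr; apply: ler_sum => i _.
by rewrite /E mulrAC ler_wpM2r ?invr_ge0 ?(ltW a_gt0)// second_difference_le.
Qed.

Lemma KL_ge0 (theta zeta : 'I_n -> R) : 0 <= KL a b theta zeta.
Proof.
rewrite mulr_ge0 ?invr_ge0 ?(ltW a_gt0)// sumr_ge0// => i _.
have := bregman_ge0 (theta i) (zeta i); lra.
Qed.

(** A substitute for the triangle inequality: no [zeta] is close to two separated parameters. Each
    summand of [KL] is a Bregman term, so the one-dimensional bound is summed over coordinates. *)
Lemma KL_pair_ge (theta theta' zeta : 'I_n -> R) :
  (forall i, Theta (theta i)) -> (forall i, Theta (theta' i)) ->
  L / (4 * a) * \sum_(i < n) (theta i - theta' i) ^+ 2 <=
    KL a b theta zeta + KL a b theta' zeta.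
Proof.
move=> T T'.
rewrite /KL -mulrDr -big_split /= invfM mulrA [_ * a^-1]mulrC -mulrA.
rewrite ler_wpM2l ?invr_ge0 ?(ltW a_gt0)// mulr_sumr; apply: ler_sum => i _.
have := bregman_pair_ge (zeta i) db bregman_ge0 Theta_itv (T i) (T' i) (ltW L_gt0) b2_ge.
lra.
Qed.

Let coord_space : measurableType _ := g_sigma_algebraType (@coord_preimages R n).

Lemma measurable_KL (theta : 'I_n -> R) th : estimator th ->
  measurable_fun setT (fun y : coord_space => KL a b theta (th y)).
Proof.
move=> mth.
have mthi i : measurable_fun setT (fun y : coord_space => th y i).
  by move=> _ B mB; rewrite setTI; exact: mth.
apply: measurable_funM => //; apply: measurable_sum => i.
apply: measurable_funD; last first.
  apply: (measurableT_comp _ (mthi i)); apply: continuous_measurable_fun => t.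
  by apply/differentiable_continuous/derivable1_diffP; case: (db t).
apply: measurable_funB => //; apply: measurable_funM => //.
by apply: measurable_funB.
Qed.

Lemma measurable_joint theta :
  measurable_fun setT (fun y : coord_space => joint theta y).
Proof.
apply: (@measurable_prod_coord R n (fun i => dens a b c (theta i))) => i.
exact: measurable_dens.
Qed.

Lemma iint_joint theta y : iint nu (enum 'I_n) (fun z => (joint theta z)%:E) y = 1%E.
Proof.
rewrite (@iint_prod_density R n nu _ (fun i => dens a b c (theta i))).
- by rewrite big_pred0// => i; rewrite mem_enum.
- exact: enum_uniq.
- by move=> i; exact: measurable_dens.
- by move=> i t; exact: dens_ge0.
- by move=> i; exact: dens1.
Qed.

(** The pointwise inequality is integrated over the observation. Every joint density has mass 1,
    also at [2 * theta f] and at 0, so the sum of the risks is at least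
    [s * N * (1 - 9 / 20 - 4 / 9)], and the maximal risk dominates their average. *)
Lemma maxrisk_ge (p0 : nat) th (F : finType) (beta : F -> 'cV[R]_p) (D s : R) :
  estimator th -> (0 < #|F|)%N -> 0 <= s ->
  (forall f, Bset X Theta p0 (beta f)) ->
  (forall f, U / a * sqnorm (X *m beta f) <= D) ->
  (forall y, expR D * #|[set f | KL a b (linpred X (beta f)) (th y) < s]%SET|%:R
             <= 4 / 5 * #|F|%:R) ->
  ((s / 10)%:E <= maxrisk X Theta p0 nu a b c th)%E.
Proof.
move=> mth F0 s0 BF hD card.
pose theta f := linpred X (beta f).
pose N : R := #|F|%:R; have N0 : 0 < N by rewrite ltr0n.
pose risk f := expect nu a b c (theta f) (fun y => (KL a b (theta f) (th y))%:E).
pose G f (y : coord_space) := ((joint (theta f) y)%:E * (KL a b (theta f) (th y))%:E)%E.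
have mJ t : measurable_fun setT (fun y : coord_space => (joint t y)%:E).
  by have /measurable_EFinP := measurable_joint t.
have mG f : measurable_fun setT (G f).
  apply: emeasurable_funM; first exact: mJ.
  by have /measurable_EFinP := measurable_KL (theta f) mth.
have J0 t y : (0 <= (joint t y)%:E)%E by rewrite lee_fin.
have G0 f y : (0 <= G f y)%E by rewrite mule_ge0 ?lee_fin ?KL_ge0.
pose sumJ (t : F -> 'I_n -> R) (y : coord_space) : \bar R :=
  (\sum_f (joint (t f) y)%:E)%E.
have sumJ0 t y : (0 <= sumJ t y)%E.
  by apply: sume_ge0 => f _; rewrite lee_fin.
have msumJ t : measurable_fun setT (sumJ t).
  by apply: emeasurable_sum => f; exact: mJ.
have iint_sumJ t y : iint nu (enum 'I_n) (sumJ t) y = N%:E.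
  rewrite iint_sum//; last by move=> f; exact: mJ.
  under eq_bigr do rewrite iint_joint.
  by rewrite sumEFin sumr_const.
have risk_sum : ((s * N)%:E <=
    \sum_f risk f + ((9 / 20 * s * N)%:E + (4 / 9 * s * N)%:E))%E.
  pose H2 (y : coord_space) :=
    ((9 / 20 * s)%:E * sumJ (fun f i => (2 * theta f i)%R) y)%E.
  pose H0 (y : coord_space) := ((4 / 9 * s * N)%:E * (joint (fun=> 0) y)%:E)%E.
  have c2 : 0 <= 9 / 20 * s by rewrite mulr_ge0.
  have c0 : 0 <= 4 / 9 * s * N by rewrite !mulr_ge0// ltW.
  have mH2 : measurable_fun setT H2 by apply: measurable_funeM; exact: msumJ.
  have mH0 : measurable_fun setT H0 by apply: measurable_funeM; exact: mJ.
  have H20 y : (0 <= H2 y)%E by apply: mule_ge0; rewrite ?lee_fin.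
  have H00 y : (0 <= H0 y)%E by apply: mule_ge0; rewrite ?lee_fin.
  have mGs : measurable_fun setT (fun y : coord_space => \sum_f G f y)%E.
    by apply: emeasurable_sum => f; exact: mG.
  have Gs0 y : (0 <= \sum_f G f y)%E by apply: sume_ge0 => f _; exact: G0.
  pose z0 : 'I_n -> R := fun=> 0.
  have -> : (s * N)%:E =
      iint nu (enum 'I_n) (fun y => s%:E * sumJ theta y)%E z0.
    by rewrite iintZ ?iint_sumJ ?EFinM//; exact: msumJ.
  have -> : (9 / 20 * s * N)%:E = iint nu (enum 'I_n) H2 z0.
    by rewrite iintZ ?iint_sumJ ?EFinM//; exact: msumJ.
  have -> : (4 / 9 * s * N)%:E = iint nu (enum 'I_n) H0 z0.
    by rewrite iintZ ?iint_joint ?mule1//; exact: mJ.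
  have -> : (\sum_f risk f)%E = iint nu (enum 'I_n) (fun y => \sum_f G f y)%E z0.
    by rewrite iint_sum.
  rewrite -iintD// -iintD//; last 2 first.
  - exact: emeasurable_funD.
  - by move=> y; exact: adde_ge0.
  apply: le_iint => //.
  - by apply: measurable_funeM; exact: msumJ.
  - by apply: emeasurable_funD => //; exact: emeasurable_funD.
  - by move=> y; apply: mule_ge0; rewrite ?lee_fin.
  move=> y; rewrite /G /H2 /H0 /sumJ.
  under [X in (_ <= X + _)%E]eq_bigr do rewrite -EFinM.
  rewrite !sumEFin -!EFinM -!EFinD lee_fin addrA.
  apply: (pointwise_risk_ge (K := expR D)) => //.
  - by move=> f; exact: KL_ge0.
  - by move=> f; apply: joint_sqr_le; exact: hD.
have risk_le f : (risk f <= maxrisk X Theta p0 nu a b c th)%E.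
  by apply: ereal_sup_ubound; exists (beta f).
have risk_ge0 f : (0 <= risk f)%E by apply: iint_ge0 => y; exact: G0.
have /card_gt0P[f0 _] := F0.
(* An infinite maximal risk is trivial, and the value [-oo] contradicts the nonnegativity of the
   risk at [f0]. *)
move: risk_le; case: (maxrisk _ _ _ _ _ _ _ _) => [r| |] risk_le; last 2 first.
- by rewrite leey.
- by have := le_trans (risk_ge0 f0) (risk_le f0).
have : (\sum_f risk f <= (r * N)%:E)%E.
  have -> : (r * N)%:E = (\sum_(f : F) r%:E)%E by rewrite sumEFin sumr_const mulr_natr.
  by apply: lee_sum => f _; exact: risk_le.
move=> /(leeD2r ((9 / 20 * s * N)%:E + (4 / 9 * s * N)%:E)%E).
move=> /(le_trans risk_sum); rewrite -!EFinD !lee_fin => h.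
(* [1 - 9 / 20 - 4 / 9 = 19 / 180 >= 1 / 10]. *)
rewrite -(ler_pM2r N0); have := mulr_ge0 s0 (ltW N0); lra.
Qed.

(** Here [s] is half the lower bound on the sum of the losses of two words at distance more than
    [q / 16], so words of loss below [s] are pairwise within [q / 16]. *)
Lemma maxrisk_indic_ge (q m p0 k : nat) (S : {ffun 'I_q -> 'I_m} -> {set 'I_p})
    (C : R) th :
  estimator th -> (1 < m)%N -> (0 < q)%N ->
  (forall f, (#|S f| <= q)%N) -> (forall f g, (#|S f :|: S g| <= k)%N) ->
  (forall f g, (hamming f g <= #|(S f :\: S g) :|: (S g :\: S f)|)%N) ->
  U / a * (phi_max X k * C ^+ 2) <= ln m.+1%:R / 16 ->
  (forall f, Bset X Theta p0 (indic_col C (S f))) ->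
  ((L / (8 * a) * (phi_min X k * C ^+ 2) * (q%:R / 16) / 10)%:E
     <= maxrisk X Theta p0 nu a b c th)%E.
Proof.
move=> mth m1 q0 Sq Sk Sham hC SB.
pose beta f := indic_col C (S f).
have kappa_ge0 : 0 <= L / (8 * a) * (phi_min X k * C ^+ 2).
  apply: mulr_ge0; last by rewrite mulr_ge0 ?phi_min_ge0 ?sqr_ge0.
  by rewrite divr_ge0 ?mulr_ge0 ?(ltW L_gt0) ?(ltW a_gt0).
have m0 : 0 < m.+1%:R :> R by [].
(* This [D] gives [expR D = v^q] with [v^16 = m + 1], the form of the Hamming ball bound. *)
apply: (@maxrisk_ge p0 th _ beta (q%:R * (ln m.+1%:R / 16))) => //.
- by rewrite card_ffun !card_ord expn_gt0 ltnW.
- by rewrite mulr_ge0// divr_ge0.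
- move=> f; apply: (@le_trans _ _ (U / a * (phi_max X k * (C ^+ 2 * q%:R)))).
    rewrite ler_wpM2l ?divr_ge0 ?(ltW U_gt0) ?(ltW a_gt0)//.
    have lk : (l0norm (beta f) <= k)%N.
      by apply: leq_trans (l0norm_indic_col _ _) _; rewrite -[S f]finset.setUid.
    apply: le_trans (sqnorm_mulmx_le X lk) _.
    rewrite sqnorm_indic_col ler_wpM2l ?phi_max_ge0// ler_wpM2l ?sqr_ge0//.
    by rewrite ler_nat.
  have := ler_wpM2l (ler0n R q) hC; lra.
- move=> y; rewrite expRM_natl card_ffun !card_ord natrX.
  apply: card_hamming_ball => //.
  + exact: expR_gt0.
  + by rewrite -expRM_natl mulrCA divff ?mulr1 ?lnK ?posrE.
  move=> f g; rewrite !inE => hf hg; rewrite leqNgt; apply/negP => qlt.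
  have := KL_pair_ge (th y) (SB f).1 (SB g).1.
  have -> : \sum_(i < n) (linpred X (beta f) i - linpred X (beta g) i) ^+ 2
      = sqnorm (X *m (beta f - beta g)).
    by apply: eq_bigr => i _; rewrite /linpred mulmxBr !mxE.
  have lk : (l0norm (beta f - beta g) <= k)%N.
    exact: leq_trans (l0norm_indic_colB _ _ _) (Sk f g).
  have := sqnorm_mulmx_ge X lk; rewrite sqnorm_indic_colB.
  have A0 : 0 <= L / (8 * a) by rewrite divr_ge0 ?mulr_ge0 ?(ltW L_gt0) ?(ltW a_gt0).
  move=> /(ler_wpM2l A0) h1.
  have -> : L / (4 * a) = 2 * (L / (8 * a)) by field; rewrite gt_eqF.
  move=> h2.
  have : q%:R / 16 <= #|(S f :\: S g) :|: (S g :\: S f)|%:R :> R.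
    rewrite ler_pdivrMr// -natrM ler_nat mulnC (leq_trans (ltnW qlt))//.
    by rewrite leq_mul2l Sham.
  move=> /(ler_wpM2l kappa_ge0); lra.
Qed.

End minimax.

(** * Supports encoded by words *)

Section supports.
Context {p q : nat}.

Definition block_support m (e : 'I_q -> 'I_m -> 'I_p) (f : {ffun 'I_q -> 'I_m}) :
  {set 'I_p} := [set e i (f i) | i in 'I_q]%SET.

Section blocks.
Context {m : nat} (e : 'I_q -> 'I_m -> 'I_p).
Hypothesis e_inj : forall i j i' j', e i j = e i' j' -> i = i' /\ j = j'.

Lemma card_block_support f : #|block_support e f| = q.
Proof. by rewrite card_imset ?card_ord// => i i' /e_inj[]. Qed.

Lemma mem_block_support f i j : (e i j \in block_support e f) = (f i == j).
Proof.
apply/imsetP/eqP => [[i' _ /e_inj[-> ->]]//|<-].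
by exists i.
Qed.

(** Each position where the words differ yields its own index [e i (f i)], in the support of [f] but
    not of [g]. *)
Lemma hamming_block_support f g :
  (hamming f g <= #|(block_support e f :\: block_support e g)
                     :|: (block_support e g :\: block_support e f)|)%N.
Proof.
rewrite /hamming -(card_imset [set i | f i != g i]%SET (f := fun i => e i (f i))); last first.
  by move=> i i' /e_inj[].
apply/subset_leq_card/fintype.subsetP => _ /imsetP[i + ->].
by rewrite !inE !mem_block_support eqxx eq_sym => ->.
Qed.

End blocks.

Context (qp : (q <= p)%N).

(** A word over ['I_2] is a characteristic function: the letter [ord_max] switches a coordinate
    on. *)
Definition cube_support (f : {ffun 'I_q -> 'I_2}) : {set 'I_p} :=
  [set widen_ord qp i | i in [set i | f i == ord_max]%SET]%SET.

Lemma mem_cube_support f i :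
  (widen_ord qp i \in cube_support f) = (f i == ord_max).
Proof.
rewrite mem_imset ?inE// => j j' /(congr1 val) /= jj'; exact: val_inj.
Qed.

Lemma cube_support_lt f j : j \in cube_support f -> (j < q)%N.
Proof. by case/imsetP => i _ ->; exact: (ltn_ord i). Qed.

Lemma card_lt_ord (A : {set 'I_p}) : (forall j, j \in A -> (j < q)%N) -> (#|A| <= q)%N.
Proof.
move=> Aq; rewrite -[leqRHS](card_ord q) -(card_imset 'I_q (f := widen_ord qp)).
  apply/subset_leq_card/fintype.subsetP => j jA; apply/imsetP.
  by exists (Ordinal (Aq j jA)) => //; exact: val_inj.
by move=> j j' /(congr1 val) /= jj'; exact: val_inj.
Qed.

Lemma hamming_cube_support f g :
  (hamming f g <= #|(cube_support f :\: cube_support g)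
                     :|: (cube_support g :\: cube_support f)|)%N.
Proof.
rewrite /hamming -(card_imset [set i | f i != g i]%SET (f := widen_ord qp)); last first.
  by move=> j j' /(congr1 val) /= jj'; exact: val_inj.
apply/subset_leq_card/fintype.subsetP => _ /imsetP[i + ->].
rewrite !inE !mem_cube_support.
by case: (f i) => [[|[|]]//= ?]; case: (g i) => [[|[|]]//= ?].
Qed.

End supports.


(** * Numerical bounds on exp and ln *)

Section constants.
Context {R : realType}.

Lemma expR_half_le2 : expR (2^-1 : R) <= 2.
Proof.
have := expR_ge1Dx (- 2^-1 : R); rewrite expRN => h.
rewrite -(@lef_pV2 _ 2) ?posrE ?expR_gt0//; lra.
Qed.

Lemma expR1_le4 : expR (1 : R) <= 4.
Proof.
have -> : expR (1 : R) = expR 2^-1 ^+ 2 by rewrite -expRM_natl divff.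
have := expR_half_le2; have := expR_ge0 (2^-1 : R); nra.
Qed.

Lemma ln2_ge_half : 2^-1 <= ln (2 : R).
Proof. by rewrite -[leLHS]expRK ler_ln ?posrE ?expR_gt0// expR_half_le2. Qed.

Lemma ln_ratio_gt0 (x y : nat) : (0 < y)%N -> (y <= x)%N ->
  0 < ln (x%:R * expR 1 / y%:R : R).
Proof.
move=> y0 yx; rewrite ln_gt0// ltr_pdivlMr ?ltr0n// mul1r.
apply: (@le_lt_trans _ _ x%:R); first by rewrite ler_nat.
by rewrite ltr_pMr ?expR_gt1 ?ltr0n// (leq_trans y0).
Qed.

(* [x / y * e < 4 (m + 1) <= (m + 1)^3] for [m = x %/ y >= 2]. *)
Lemma ln_ratio_le (x y : nat) : (0 < y)%N -> (2 * y <= x)%N ->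
  ln (x%:R * expR 1 / y%:R : R) <= 3 * ln (x %/ y).+1%:R.
Proof.
move=> y0 yx; have x0 : (0 < x)%N by lia.
have m2 : (2 <= x %/ y)%N by rewrite leq_divRL.
have -> : 3 * ln (x %/ y).+1%:R = ln ((x %/ y).+1%:R ^+ 3) :> R.
  by rewrite lnXn ?ltr0n// mulr_natl.
rewrite ler_ln ?posrE ?exprn_gt0 ?divr_gt0 ?mulr_gt0 ?expR_gt0 ?ltr0n//.
rewrite ler_pdivrMr ?ltr0n//.
apply: (@le_trans _ _ (x%:R * 4)); first by rewrite ler_wpM2l// expR1_le4.
rewrite -natrX -!natrM ler_nat.
have := ltn_ceil x y0; nia.
Qed.

End constants.

(** * The sparse and the dense regime *)

Section sparse_and_dense.
Context {R : realType} {n p : nat} (X : 'M[R]_(n, p)).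
Context (nu : {measure set R -> \bar R}) (a : R) (b c : R -> R).
Context (Theta : set R) (L U : R) (p0 : nat).
Hypothesis nu_sigma_finite : sigma_finite setT nu.
Hypothesis mc : measurable_fun setT c.
Hypothesis dens1 : forall t, (\int[nu]_y (dens a b c t y)%:E)%E = 1%E.
Hypothesis Theta_itv : is_interval Theta.
Hypothesis db : forall t, derivable b t 1 /\ derivable (derive1 b) t 1.
Hypotheses (L_gt0 : 0 < L) (U_gt0 : 0 < U).
Hypothesis b2_le : forall t, derive1 (derive1 b) t <= U.
Hypothesis b2_ge : forall t, Theta t -> L <= derive1 (derive1 b) t.
Hypothesis a_gt0 : 0 < a.
Hypotheses (X_neq0 : X != 0) (p0_gt0 : (0 < p0)%N).

(** Two supports of size [p0] have a union of size at most [2 * p0], whence [k]. The factor [3^-1]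
    in the amplitude makes [U / a * phi_max * C^2] equal to [ell / 48], which is at most
    [ln (m + 1) / 16] because [ell <= 3 * ln (m + 1)]. *)
Lemma maxrisk_sparse_ge th : (2 * p0 <= p)%N ->
  Btilde1 X 3^-1 a U p0 `<=` Bset X Theta p0 -> estimator th ->
  (((8 * 10 * 16 * 48)^-1 * (L / U) * tau X (2 * p0) * p0%:R * ln (p%:R * expR 1 / p0%:R))%:E
     <= maxrisk X Theta p0 nu a b c th)%E.
Proof.
move=> p0p BB mth.
pose m := (p %/ p0)%N.
have m2 : (1 < m)%N by rewrite leq_divRL.
have p_gt0 : (0 < p)%N by lia.
(* Block [i] consists of the indices [i * m + j]; the blocks fit because [p0 * m <= p]. *)
have e_lt (i : 'I_p0) (j : 'I_m) : (i * m + j < p)%N.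
  apply: (@leq_trans (p0 * m)); last by rewrite mulnC leq_trunc_div.
  rewrite (@leq_trans (i.+1 * m))//; last by rewrite leq_mul2r ltn_ord orbT.
  by rewrite mulSn addnC ltn_add2r.
pose e i j := Ordinal (e_lt i j).
have e_inj i j i' j' : e i j = e i' j' -> i = i' /\ j = j'.
  move=> /(congr1 val) /= ee.
  have m0 : (0 < m)%N by lia.
  have := congr1 (divn^~ m) ee; have := congr1 (modn^~ m) ee.
  rewrite /= !modnMDl !modn_small// !divnMDl// !divn_small// !addn0.
  by move=> jj ii; split; exact: val_inj.
set ell := ln (p%:R * expR 1 / p0%:R).
have ell_gt0 : 0 < ell by apply: ln_ratio_gt0 => //; lia.
have phi0 : 0 < phi_max X (2 * p0) by rewrite phi_max_gt0// muln_gt0.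
pose C2 := 16^-1 * 3^-1 * (a / U) * (phi_max X (2 * p0))^-1 * ell.
have C20 : 0 < C2 by rewrite /C2 !mulr_gt0 ?invr_gt0 ?mulr_gt0.
pose C := Num.sqrt C2.
have CE : C ^+ 2 = C2 by rewrite sqr_sqrtr// ltW.
(* Otherwise the zero entries would be counted among those equal to [C] in [Btilde1]. *)
have C0 : C != 0 by rewrite gt_eqF// sqrtr_gt0.
have := @maxrisk_indic_ge R n p X nu a b c Theta L U nu_sigma_finite mc dens1 Theta_itv
  db L_gt0 U_gt0 b2_le b2_ge a_gt0 p0 m p0 (2 * p0)%N (block_support e) C th mth m2 p0_gt0.
rewrite CE.
have -> : L / (8 * a) * (phi_min X (2 * p0) * C2) * (p0%:R / 16) / 10 =
    (8 * 10 * 16 * 48)^-1 * (L / U) * tau X (2 * p0) * p0%:R * ell.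
  by rewrite /C2 /tau; field; rewrite !gt_eqF.
apply.
- by move=> f; rewrite card_block_support.
- move=> f g; rewrite (leq_trans (leq_card_setU _ _))//.
  by rewrite !card_block_support// mul2n addnn.
- exact: hamming_block_support.
- have -> : U / a * (phi_max X (2 * p0) * C2) = 48^-1 * ell.
    by rewrite /C2; field; rewrite !gt_eqF.
  have := @ln_ratio_le R p p0 p0_gt0 p0p; rewrite -/ell -/m; lra.
- move=> f; apply: BB; split => [j|].
    by rewrite mxE; case: ifP => _; [right|left].
  rewrite -[RHS](card_block_support e_inj f); apply: eq_card => j.
  apply/idP/idP => [/set_mem /=|jS]; first by rewrite mxE; case: ifP => //; rewrite eq_sym (negPf C0).
  by apply/mem_set; rewrite /= mxE jS.
Qed.

(** All supports lie in the first [p0] coordinates, so unions have size at most [p0] and [k = p0].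
    The budget holds as [ln 2 / 64 <= ln 3 / 16], and [ln 2 >= 1 / 2] turns 64 into 128. *)
Lemma maxrisk_dense_ge th : (p0 <= p)%N ->
  Btilde2 X a U p0 `<=` Bset X Theta p0 -> estimator th ->
  (((8 * 10 * 16 * 128)^-1 * (L / U) * tau X p0 * p0%:R)%:E
     <= maxrisk X Theta p0 nu a b c th)%E.
Proof.
move=> p0p BB mth.
have phi0 : 0 < phi_max X p0 by rewrite phi_max_gt0.
have l2 := @ln2_ge_half R.
have l20 : 0 < ln 2 :> R by lra.
pose C2 := ln 2 / 64 * (a / U) * (phi_max X p0)^-1.
have C20 : 0 < C2 by rewrite /C2 !mulr_gt0 ?invr_gt0.
pose C := Num.sqrt C2.
have CE : C ^+ 2 = C2 by rewrite sqr_sqrtr// ltW.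
have := @maxrisk_indic_ge R n p X nu a b c Theta L U nu_sigma_finite mc dens1 Theta_itv
  db L_gt0 U_gt0 b2_le b2_ge a_gt0 p0 2 p0 p0 (cube_support p0p) C th mth isT p0_gt0.
rewrite CE => h; apply: le_trans (h _ _ _ _ _).
- have -> : L / (8 * a) * (phi_min X p0 * C2) * (p0%:R / 16) / 10 =
      (8 * 10 * 16 * 64)^-1 * ln 2 * (L / U * tau X p0 * p0%:R).
    by rewrite /C2 /tau; field; rewrite !gt_eqF.
  have T0 : 0 <= L / U * tau X p0 * p0%:R.
    by rewrite !mulr_ge0 ?invr_ge0 ?phi_min_ge0 ?phi_max_ge0 ?(ltW L_gt0) ?(ltW U_gt0).
  by rewrite lee_fin; have := ler_wpM2r T0 l2; lra.
- by move=> f; apply: (card_lt_ord p0p) => j; exact: cube_support_lt.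
- move=> f g; apply: (card_lt_ord p0p) => j.
  by rewrite inE => /orP[]; exact: cube_support_lt.
- exact: hamming_cube_support.
- have -> : U / a * (phi_max X p0 * C2) = ln 2 / 64.
    by rewrite /C2; field; rewrite !gt_eqF.
  have : ln 2 <= ln 3 :> R by rewrite ler_ln ?posrE// ler_nat.
  lra.
- move=> f; apply: BB => j; split => jp; rewrite mxE; case: ifP => [jS|_].
  + by right.
  + by left.
  + by have := cube_support_lt jS; rewrite ltnNge jp.
  + by [].
Qed.

End sparse_and_dense.

(** * Absolute constants and the two cases *)

Theorem theorem2 :
  exists ct C2 : RR, 0 < ct < 1 /\ 0 < C2 /\
  forall (n p r : nat) (X : 'M[RR]_(n, p))
         (nu : {measure set RR -> \bar RR})
         (a : RR) (b c : RR -> RR)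
         (Theta : set RR) (L U : RR) (p0 : nat),
    (* design: rank r, any r columns linearly independent *)
    \rank X = r ->
    (forall f : 'I_r -> 'I_p, injective f -> \rank (colsub f X) = r) ->
    (* exponential family with base measure nu: f_theta is a density for every theta *)
    sigma_finite setT nu ->
    measurable_fun setT c ->
    (forall t, (\int[nu]_y (dens a b c t y)%:E)%E = 1%E) ->
    (* Assumption (A) *)
    closed Theta -> is_interval Theta -> Theta !=set0 ->
    (forall t, derivable b t 1 /\ derivable (derive1 b) t 1) ->
    0 < L -> L <= U ->
    (forall t, (derive1 (derive1 b)) t <= U) ->
    (forall t, Theta t -> L <= (derive1 (derive1 b)) t) ->
    0 < a ->
    (1 <= p0 <= r)%N ->
    ((2 * p0 <= r)%N ->
       Btilde1 X ct a U p0 `<=` Bset X Theta p0 ->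
       forall th, estimator th ->
         ((C2 * (L / U) * tau X (2 * p0) * p0%:R * ln (p%:R * expR 1 / p0%:R))%:E
            <= maxrisk X Theta p0 nu a b c th)%E)
    /\
    ((r <= 2 * p0)%N ->
       Btilde2 X a U p0 `<=` Bset X Theta p0 ->
       forall th, estimator th ->
         ((C2 * (L / U) * tau X p0 * r%:R)%:E
            <= maxrisk X Theta p0 nu a b c th)%E).
Proof.
(* 256 is twice the 128 of the dense case, which pays for replacing [p0] by [r <= 2 * p0]; the
   sparse constant is larger. *)
exists 3^-1, (8 * 10 * 16 * 256)^-1; split; first by apply/andP; split; lra.
split; first lra.
move=> n p r X nu a b c Theta L U p0 rX _ nuS mc dens1 _ Titv _ db L0 LU bU bL a0.
case/andP => p01 p0r.
have U0 : 0 < U := lt_le_trans L0 LU.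
have X0 : X != 0 by rewrite -mxrank_eq0 rX -lt0n (leq_trans p01).
have rp : (r <= p)%N by rewrite -rX rank_leq_col.
have tau0 k : 0 <= tau X k by rewrite divr_ge0 ?phi_min_ge0 ?phi_max_ge0.
have LU0 : 0 <= L / U by rewrite divr_ge0 ?ltW.
split => hr BB th mth.
- apply: le_trans (maxrisk_sparse_ge nuS mc dens1 Titv db L0 U0 bU bL a0 X0 p01
    (leq_trans hr rp) BB mth).
  have : 0 <= L / U * tau X (2 * p0) * p0%:R * ln (p%:R * expR 1 / p0%:R).
    apply: mulr_ge0; first exact: mulr_ge0 (mulr_ge0 LU0 (tau0 _)) (ler0n _ _).
    by apply/ltW/ln_ratio_gt0 => //; exact: leq_trans p0r rp.
  rewrite lee_fin; lra.
- apply: le_trans (maxrisk_dense_ge nuS mc dens1 Titv db L0 U0 bU bL a0 X0 p01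
    (leq_trans p0r rp) BB mth).
  have : r%:R <= 2 * p0%:R :> RR by rewrite -natrM ler_nat.
  move=> /(ler_wpM2l (mulr_ge0 LU0 (tau0 p0))).
  rewrite lee_fin; lra.
Qed.
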